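(* Let $(X,T)$ be a minimal topological dynamical system and $d\in\mathbb{N}$. If $(X,T)$ is distal (respectively PI, HPI), then so is $(N_d(X),\mathcal{G}_d(T))$.
   Context: $N_d(X)=\overline{\{(T^{p+q}x,\dots,T^{p+dq}x):x\in X,p,q\in\mathbb{Z}\}}$, $\mathcal{G}_d(T)$ is the group generated by $T\times\cdots\times T$ and $T\times T^2\times\cdots\times T^d$ acting on $X^d$. For a minimal system $(X,G)$: it is strictly PI if there are a countable ordinal $\eta$ and minimal systems $(X_\lambda,G)$, $0\le\lambda\le\eta$, with $X_0$ a point, $X_\eta=X$, for each successor $\lambda+1\le\eta$ an extension $X_{\lambda+1}\to X_\lambda$ that is either proximal or equicontinuous, and for each limit $\lambda$, $X_\lambda$ the inverse limit of $(X_\mu)_{\mu<\lambda}$. $(X,G)$ is PI if there is a strictly PI system $\tilde X$ and a proximal extension $\tilde X\to X$. $(X,G)$ is HPI if it admits such a tower in which each successor extension is either almost one-to-one or equicontinuous. Extensions: proximal means all pairs in the same fibre are proximal; equicontinuous means for all $\varepsilon>0$ there is $\delta>0$ with $\sup_g\rho(gx,gx')<\varepsilon$ whenever $x,x'$ are in the same fibre and $\rho(x,x')<\delta$; almost one-to-one means some fibre is a singleton. Distal: no two distinct points are proximal. *)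

(* Defs.v *)
From HB Require Import structures.
From mathcomp Require Import all_boot all_order all_algebra.
From mathcomp Require Import all_classical all_reals all_analysis.
Set Implicit Arguments.
Unset Strict Implicit.
Unset Printing Implicit Defensive.
Import Order.TTheory GRing.Theory Num.Theory.
Import ArrowAsUniformType.
Local Open Scope classical_set_scope.
Local Open Scope ring_scope.

(** * Topological dynamical systems (X, G)

  The acting group is an abelian group [G : zmodType] together with a
  subgroup [K] that is required to act trivially; a "(G/K)-system" is
  thus encoded as a [G]-system on which [K] acts trivially.  (This is how
  we encode the group G_d(T), a quotient of Z^2.)  The phase space is a
  compact Hausdorff (hence metric) pseudometric space; the metric rho is
  expressed via [ball]: rho(x,y) < e  <->  ball x e y. *)

Record system (R : realType) (G : zmodType) := Sys {
  sp :> pseudoMetricType R;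
  act : G -> sp -> sp }.
Arguments Sys {R G}.
Arguments act {R G} s.

Section Dyn.
Variables (R : realType) (G : zmodType).

Definition is_system (K : set G) (S : system R G) : Prop :=
  [/\ hausdorff_space S, compact [set: S],
      (forall g, continuous (act S g)) &
      [/\
      (forall x, act S 0 x = x),
      (forall g h x, act S (g + h) x = act S g (act S h x))
    & (forall k, K k -> forall x, act S k x = x)]].

Definition minimal (S : system R G) : Prop :=
  forall x : S, closure (range (fun g => act S g x)) = [set: S].

Definition proximal_pair (S : system R G) (x y : S) : Prop :=
  forall e : R, 0 < e -> exists g, ball (act S g x) e (act S g y).

Definition distal (S : system R G) : Prop :=
  forall x y : S, proximal_pair x y -> x = y.

Definition factor_map (S1 S2 : system R G) (pi : S1 -> S2) : Prop :=
  [/\ continuous pi, (forall y, exists x, pi x = y)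
    & (forall g x, pi (act S1 g x) = act S2 g (pi x))].

Definition iso_map (S1 S2 : system R G) (pi : S1 -> S2) : Prop :=
  factor_map pi /\ injective pi.

Definition proximal_ext (S1 S2 : system R G) (pi : S1 -> S2) : Prop :=
  forall x y, pi x = pi y -> proximal_pair x y.

Definition equicontinuous_ext (S1 S2 : system R G) (pi : S1 -> S2) : Prop :=
  forall e : R, 0 < e -> exists2 dl : R, 0 < dl &
    forall x y, pi x = pi y -> ball x dl y ->
      forall g, ball (act S1 g x) e (act S1 g y).

Definition almost_one_one_ext (S1 S2 : system R G) (pi : S1 -> S2) : Prop :=
  exists x, forall y, pi y = pi x -> y = x.

Definition ext_kind := forall (S1 S2 : system R G), (S1 -> S2) -> Prop.

Definition prox_or_equi : ext_kind :=
  fun S1 S2 pi => proximal_ext pi \/ equicontinuous_ext pi.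
Definition a11_or_equi : ext_kind :=
  fun S1 S2 pi => almost_one_one_ext pi \/ equicontinuous_ext pi.

(** Towers indexed by the ordinals 0 <= lambda <= eta, eta countable.
    The index set is encoded as a countable well-ordered type [tI]
    (strict order [tlt]) with a least element [0] and a greatest element
    [eta]; such a type is exactly (isomorphic to) the set of ordinals
    <= eta for a countable ordinal eta.  [tpi l m] is the factor map
    X_l -> X_m for m <= l (irrelevant otherwise). *)
Record tower := Tower {
  tI : Type;
  tlt : tI -> tI -> Prop;
  tsys : tI -> system R G;
  tpi : forall l m : tI, tsys l -> tsys m }.
Arguments tlt : clear implicits.
Arguments tsys : clear implicits.
Arguments tpi : clear implicits.

Definition tle (T : tower) (m l : tI T) := m = l \/ tlt T m l.

Definition is_tower (K : set G) (P : ext_kind) (T : tower)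
    (S : system R G) : Prop :=
  (forall l, ~ tlt T l l) /\
  (forall l m n, tlt T l m -> tlt T m n -> tlt T l n) /\
  (forall l m, [\/ tlt T l m, l = m | tlt T m l]) /\
  well_founded (tlt T) /\
  (exists f : tI T -> nat, injective f) /\
  (exists bot top : tI T,
     (forall l, tle bot l) /\ (forall l, tle l top) /\
     (exists x0 : tsys T bot, forall x : tsys T bot, x = x0) /\
     (exists phi : tsys T top -> S, iso_map phi)) /\
  (forall l, is_system K (tsys T l) /\ minimal (tsys T l)) /\
  (forall l (x : tsys T l), tpi T l l x = x) /\
  (forall l m, tlt T m l -> factor_map (tpi T l m)) /\
  (forall l m n (x : tsys T l), tlt T n m -> tlt T m l ->
      tpi T m n (tpi T l m x) = tpi T l n x) /\
  (forall l m, tlt T m l -> (forall k, ~ (tlt T m k /\ tlt T k l)) ->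
      P _ _ (tpi T l m)) /\
  (* limit steps: X_l is the inverse limit of (X_m)_{m<l} *)
  (forall l, (exists m, tlt T m l) ->
     (forall m, tlt T m l -> exists k, tlt T m k /\ tlt T k l) ->
     forall xs : (forall m, tlt T m l -> tsys T m),
       (forall m n (hm : tlt T m l) (hn : tlt T n l), tlt T n m ->
           tpi T m n (xs m hm) = xs n hn) ->
       exists! x : tsys T l, forall m (hm : tlt T m l), tpi T l m x = xs m hm).

Definition strictly_PI (K : set G) (S : system R G) : Prop :=
  exists T : tower, is_tower K prox_or_equi T S.

Definition PI (K : set G) (S : system R G) : Prop :=
  exists (S' : system R G) (pi : S' -> S),
    is_system K S' /\ minimal S' /\ strictly_PI K S' /\
    factor_map pi /\ proximal_ext pi.

Definition HPI (K : set G) (S : system R G) : Prop :=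
  exists T : tower, is_tower K a11_or_equi T S.

End Dyn.

Definition zpow {X : Type} (T Tinv : X -> X) (n : int) : X -> X :=
  match n with
  | Posz k => iter k T
  | Negz k => iter k.+1 Tinv
  end.

Definition Zsys (R : realType) (X : pseudoMetricType R) (T Tinv : X -> X)
  : system R int := Sys X (zpow T Tinv).

(** * N_d(X) and G_d(T).
   The element (m,n) of Z^2 acts on X^d = ('I_d -> X) by
   (T x ... x T)^m (T x T^2 x ... x T^d)^n, i.e. coordinate i (0-based)
   is moved by T^(m + n (i+1)).  G_d(T) is the image of this action, i.e.
   Z^2 modulo the kernel [Gd_ker]. *)
Definition Gd_act (R : realType) (X : pseudoMetricType R) (T Tinv : X -> X)
  (d : nat) (g : (int * int)%type) (x : 'I_d -> X) : 'I_d -> X :=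
  fun i => zpow T Tinv (g.1 + g.2 * (i.+1)%:Z) (x i).

Definition Gd_ker (R : realType) (X : pseudoMetricType R) (T Tinv : X -> X)
  (d : nat) : set (int * int)%type :=
  [set g | forall x : 'I_d -> X, Gd_act T Tinv g x = x].

Definition Nd (R : realType) (X : pseudoMetricType R) (T Tinv : X -> X)
  (d : nat) : set ('I_d -> X) :=
  closure [set y | exists (x : X) (p q : int),
                    y = fun i : 'I_d => zpow T Tinv (p + (i.+1)%:Z * q) x].

Arguments Nd {R X} T Tinv d.
Arguments Gd_ker {R X} T Tinv d.

(** The action of G_d(T) restricted to N_d(X) (which is invariant; the
    [else] branch is never used and only avoids a proof term). *)
Definition Nd_act (R : realType) (X : pseudoMetricType R) (T Tinv : X -> X)
  (d : nat) (g : (int * int)%type) (y : Nd T Tinv d) : Nd T Tinv d :=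
  match pselect (Nd T Tinv d (Gd_act T Tinv g (val y))) with
  | left h => exist _ (Gd_act T Tinv g (val y)) (mem_set h)
  | right _ => y
  end.

Definition Nd_sys (R : realType) (X : pseudoMetricType R) (T Tinv : X -> X)
  (d : nat) : system R (int * int)%type :=
  Sys (Nd T Tinv d : Type) (@Nd_act R X T Tinv d).
Arguments Nd_sys {R X} T Tinv d.

(* Main.v *)
Require Import Defs.
From HB Require Import structures.
From mathcomp Require Import all_boot all_order all_algebra.
From mathcomp Require Import all_classical all_reals all_analysis.
Import Order.TTheory GRing.Theory Num.Theory.
Import ArrowAsUniformType.
Local Open Scope classical_set_scope.
Local Open Scope ring_scope.
Set Implicit Arguments.
Unset Strict Implicit.
Unset Printing Implicit Defensive.

(** N_d is a functor from minimal Z-systems to Z^2-systems: a factor map pi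
  induces pi x ... x pi, and one applies N_d to every level of a tower.
  Minimality of N_d(X) is Glasner's theorem, proved with idempotents of
  enveloping semigroups.  Equicontinuous extensions lift coordinatewise; an
  almost one-to-one extension has a singleton fibre over a diagonal point;
  for a proximal extension a single element of the enveloping semigroup
  collapses any finite set of pairs in common fibres, so the diagonal action
  alone makes the lifted extension proximal.  At limit levels a compatible
  family defines a chain of nonempty closed fibres in N_d(X_l), whose
  intersection is a point because points of X_l are separated by the lower
  levels. *)

(** * Minimal closed sets and idempotents *)

Lemma closed_preimage {T U : topologicalType} (f : T -> U) (D : set U) :
  continuous f -> closed D -> closed (f @^-1` D).
Proof. by move=> cf; apply: preimage_closed => x _; exact: cf. Qed.

Lemma closed_eq_fun {T U : topologicalType} (f g : T -> U) :
  hausdorff_space U -> continuous f -> continuous g ->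
  closed [set x | f x = g x].
Proof.
move=> hU cf cg x xfg; apply: hU => A B Afx Bgx.
have [|y [fgy [Afy Bgy]]] := xfg ((f @^-1` A) `&` (g @^-1` B)).
  by apply: filterI; [exact: cf | exact: cg].
by exists (f y); split=> //; rewrite fgy.
Qed.

(** The chain condition makes the sets [A i] intersected with [C] a filter base. By compactness this
    filter has a cluster point in [C], which lies in every [A i] because each is closed. *)
Lemma compact_chain {T : topologicalType} {C : set T} {I : Type}
    (A : I -> set T) (i0 : I) :
  compact C -> (forall i, closed (A i)) -> (forall i, A i `&` C !=set0) ->
  (forall i j, A i `<=` A j \/ A j `<=` A i) ->
  exists2 x, C x & forall i, A i x.
Proof.
move=> Cco Acl A0 Ach.
pose F := filter_from [set: I] (fun i => A i `&` C).
have FF : ProperFilter F.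
  apply: filter_from_proper; last by move=> i _; exact: A0.
  apply: filter_from_filter; first by exists i0.
  move=> i j _ _; case: (Ach i j) => Aij; [exists i => // | exists j => //];
    by move=> x [Ax Cx]; do !split => //; exact: Aij.
have [x [Cx xF]] : C `&` cluster F !=set0.
  by apply: Cco; exists i0 => // x [].
exists x => // i; apply: Acl => U Ux.
have Fi : F (A i `&` C) by exists i.
by have [y [[Ay _] Uy]] := xF _ U Fi Ux; exists y.
Qed.

(** Zorn's lemma for reverse inclusion: a chain is bounded by its intersection, nonempty by
    compactness. It is applied with [P] saying subsemigroup, then left ideal. *)
Lemma minimal_closed_set {T : topologicalType} (P : set T -> Prop) (C : set T) :
  compact C -> closed C -> C !=set0 -> P C ->
  (forall F : set (set T), F !=set0 -> F `<=` P -> P (\bigcap_(A in F) A)) ->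
  exists A, [/\ A `<=` C, closed A, A !=set0, P A &
    forall B, B `<=` A -> closed B -> B !=set0 -> P B -> B = A].
Proof.
move=> Cco Ccl C0 PC Pcap.
pose good A := [/\ A `<=` C, closed A, A !=set0 & P A].
pose R (A B : {A | good A}) := `[< sval B `<=` sval A >].
have [|||chain tot|A Amax] := @Zorn {A | good A} R.
- by move=> A; apply/asboolP.
- by move=> A B D /asboolP AB /asboolP BD; apply/asboolP; exact: subset_trans AB.
- move=> [A gA] [B gB] /asboolP /= BA /asboolP /= AB.
  by apply: eq_exist; rewrite eqEsubset.
- have [/set0P[A0 cA0]|chain0] := boolP (chain != set0); last first.
    exists (exist good C (And4 (@subset_refl _ C) Ccl C0 PC)) => A cA.
    by exfalso; move/negP: chain0; apply; apply/set0P; exists A.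
  pose Ch := [set sval A | A in chain].
  have gCh : good (\bigcap_(A in Ch) A).
    split.
    + move=> x /(_ (sval A0)) h; have [AC _ _ _] := svalP A0.
      by apply: AC; apply: h; exists A0.
    + by apply: closed_bigI => _ [A _ <-]; have [_ ? _ _] := svalP A.
    + have [|||x _ xA] := @compact_chain _ C {A | chain A}
          (fun A => sval (sval A)) (exist _ _ cA0) Cco.
      * by move=> [A cA]; have [_ ? _ _] := svalP A.
      * move=> [A cA] /=; have [AC _ [x Ax] _] := svalP A.
        by exists x; split => //; exact: AC.
      * move=> [A cA] [B cB] /=.
        by case: (tot _ _ cA cB) => /asboolP; [right|left].
      by exists x => _ [A cA <-]; exact: (xA (exist _ _ cA)).
    + apply: Pcap; first by exists (sval A0); exists A0.
      by move=> _ [A _ <-]; have [_ _ _ ?] := svalP A.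
  exists (exist _ _ gCh) => A cA; apply/asboolP => x /= h.
  by apply: h; exists A.
have [AC Acl A0 PA] := svalP A.
exists (sval A); split => // B BA Bcl B0 PB.
have gB : good B by split => //; exact: subset_trans AC.
suff -> : A = exist _ _ gB by [].
by symmetry; apply: Amax; apply/asboolP.
Qed.

Section EllisNumakura.
Variables (S : topologicalType) (op : S -> S -> S).
Hypothesis opA : associative op.
Hypothesis op_cont : forall b, continuous (op^~ b).
Hypothesis S_hausdorff : hausdorff_space S.

Definition stable (A : set S) := forall a b, A a -> A b -> A (op a b).

(** Take a minimal closed subsemigroup [A] and [a] in [A]. Minimality gives [A a = A], so some [b]
    in [A] has [b a = a]; the set of such [b] is again a closed subsemigroup, hence all of [A], and
    contains [a]. *)
Lemma ellis_numakura (C : set S) :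
  compact C -> C !=set0 -> stable C -> exists2 e, C e & op e e = e.
Proof.
move=> Cco C0 Cst.
have mul_compact b A : compact A -> compact [set op a b | a in A].
  by apply: continuous_compact; apply: continuous_subspaceT; exact: op_cont.
have Ccl := compact_closed S_hausdorff Cco.
have [|A [AC Acl [a Aa] Ast Amin]] := @minimal_closed_set _ stable _ Cco Ccl C0 Cst.
  move=> F _ Fst a b aF bF A FA.
  by apply: (Fst A FA); [exact: aF | exact: bF].
have Aco : compact A by exact: subclosed_compact Cco AC.
have AaE : [set op b a | b in A] = A.
  apply: Amin.
  - by move=> _ [b Ab <-]; exact: Ast.
  - by apply: compact_closed => //; exact: mul_compact.
  - by exists (op a a); exists a.
  - move=> _ _ [b Ab <-] [c Ac <-]; exists (op (op b a) c); last by rewrite !opA.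
    by apply: (Ast) => //; apply: (Ast) => //; exact: (Ast).
have BE : [set b | A b /\ op b a = a] = A.
  apply: Amin.
  - by move=> b [].
  - apply: closedI => //.
    by apply: closed_eq_fun => //; exact: cst_continuous.
  - by move: Aa; rewrite -{1}AaE => -[b Ab ba]; exists b.
  - move=> b c [Ab ba] [Ac ca]; split; first exact: Ast.
    by rewrite -opA ca.
by exists a; [exact: AC | move: Aa; rewrite -BE => -[]].
Qed.

End EllisNumakura.

(** * Enveloping semigroups *)

Lemma closure_subsetl {T : topologicalType} (A B : set T) :
  closed B -> A `<=` B -> closure A `<=` B.
Proof. by move=> Bcl AB; apply: subset_trans Bcl; exact: closureS. Qed.

Section RightTopologicalSemigroup.
Variables (S : topologicalType) (op : S -> S -> S).
Hypothesis opA : associative op.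
Hypothesis op_cont : forall b, continuous (op^~ b).
Hypothesis S_hausdorff : hausdorff_space S.

(** Two limits are taken in turn: first in the right factor, where left translation by an element of
    [G] is continuous, then in the left factor, where every right translation is. *)
Lemma closure_stable (G : set S) :
  stable op G -> (forall a, G a -> continuous (op a)) -> stable op (closure G).
Proof.
move=> Gst Gc; have GE a b : G a -> closure G b -> closure G (op a b).
  move=> Ga; apply: (closure_subsetl (B := op a @^-1` closure G)).
    by apply: closed_preimage; [exact: Gc | exact: closed_closure].
  by move=> c Gc'; apply: subset_closure; exact: Gst.
move=> a b Ea Eb; move: a Ea.
apply: (closure_subsetl (B := op^~ b @^-1` closure G)).
  by apply: closed_preimage; [exact: op_cont | exact: closed_closure].
by move=> a Ga; exact: GE.
Qed.

(* Idempotents [v] of a minimal left ideal [L = E v] are right identities. *)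
Lemma minimal_left_ideal (E : set S) :
  compact E -> E !=set0 -> stable op E ->
  exists L, [/\ L `<=` E, closed L, L !=set0,
    forall a b, E a -> L b -> L (op a b) &
    forall e v, L e -> L v -> op v v = v -> op e v = e].
Proof.
move=> Eco E0 Est; have Ecl := compact_closed S_hausdorff Eco.
pose ideal L := forall a b, E a -> L b -> L (op a b).
have [|L [LE Lcl L0 Lid Lmin]] := @minimal_closed_set _ ideal _ Eco Ecl E0 Est.
  move=> F _ Fid a b Ea bF B FB.
  by apply: (Fid B FB) => //; exact: bF.
exists L; split=> // e v Le Lv vv.
(* [E v] is a closed left ideal inside [L], so it is [L]. Thus [e = a v] for some [a], and [v v = v]
   yields [e v = e]. *)
have EvL : [set op a v | a in E] = L.
  apply: Lmin.
  - by move=> _ [a Ea <-]; exact: Lid.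
  - apply: compact_closed => //; apply: continuous_compact => //.
    by apply: continuous_subspaceT; exact: op_cont.
  - by exists (op v v); exists v => //; exact: LE.
  - by move=> a _ Ea [b Eb <-]; exists (op a b) => //; exact: Est.
by move: Le; rewrite -EvL => -[a _ <-]; rewrite -opA vv.
Qed.

End RightTopologicalSemigroup.

Lemma continuous_into_prod {I : eqType} {K : I -> topologicalType}
    {Y : topologicalType} (f : Y -> prod_topology K) :
  (forall i, continuous (fun y => f y i)) -> continuous f.
Proof.
move=> cf y; apply/cvg_sup => i.
by apply: (@continuous_comp_initial _ _ _ (fun g : forall i, K i => g i)); exact: cf.
Qed.

Lemma continuous_proj {I : eqType} {K : I -> topologicalType} (i : I) :
  continuous (fun f : prod_topology K => f i).
Proof. exact: (@proj_continuous I K i). Qed.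

Lemma prod_hausdorff {I : eqType} {K : I -> topologicalType} :
  (forall i, hausdorff_space (K i)) -> hausdorff_space (prod_topology K).
Proof. exact: hausdorff_product. Qed.

Lemma prod_compact {I : eqType} {K : I -> topologicalType} :
  (forall i, compact [set: K i]) -> compact [set: prod_topology K].
Proof.
move=> Kco; have := @tychonoff I K (fun _ => setT) Kco.
by congr compact; apply/seteqP; split.
Qed.

(* Elements of [ell J X] act on [X ^ J] coordinatewise; the topology is that of
   pointwise convergence. *)
Definition ell (J : finType) (X : topologicalType) := {ptws (J * X)%type -> X}.

(** Composition of self-maps in each coordinate, [g] acting first. *)
Definition emul {J : finType} {X : topologicalType} (f g : ell J X) : ell J X :=
  fun jx => f (jx.1, g jx).

Definition enveloping {J : finType} {X : topologicalType} {G : Type}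
  (a : G -> J -> X -> X) : set (ell J X) :=
  closure (range (fun g => (fun jx => a g jx.1 jx.2) : ell J X)).

Section Enveloping.
Variables (R : realType) (J : finType) (X : pseudoMetricType R) (G : zmodType).
Hypotheses (hX : hausdorff_space X) (cX : compact [set: X]).
Variable a : G -> J -> X -> X.
Hypothesis a_cont : forall g j, continuous (a g j).
Hypothesis aD : forall g h j x, a (g + h) j x = a g j (a h j x).

Lemma emulA : associative (@emul J X).
Proof. by []. Qed.

Lemma emul_cont (g : ell J X) : continuous (emul^~ g).
Proof. by apply: continuous_into_prod => jx; exact: continuous_proj. Qed.

Lemma ell_hausdorff : hausdorff_space (ell J X).
Proof. by apply: prod_hausdorff => _; exact: hX. Qed.

Lemma ell_compact : compact [set: ell J X].
Proof. by apply: prod_compact => _; exact: cX. Qed.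

Lemma enveloping_compact : compact (enveloping a).
Proof.
by apply: subclosed_compact ell_compact _ => //; exact: closed_closure.
Qed.

Lemma enveloping_act g : enveloping a (fun jx => a g jx.1 jx.2).
Proof. by apply: subset_closure; exists g. Qed.

Lemma enveloping_sub (D : set (ell J X)) : closed D ->
  (forall g, D (fun jx => a g jx.1 jx.2)) -> enveloping a `<=` D.
Proof. by move=> Dcl Da; apply: closure_subsetl => // _ [g _ <-]; exact: Da. Qed.

Lemma enveloping_stable : stable emul (enveloping a).
Proof.
apply: closure_stable; first exact: emul_cont.
- move=> _ _ [g _ <-] [h _ <-]; exists (g + h) => //.
  by apply/funext => -[j x]; rewrite /emul /= aD.
- move=> _ [g _ <-]; apply: continuous_into_prod => -[j x] f.
  apply: (@continuous_comp _ _ _ (fun h : ell J X => h (j, x)) (a g j)).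
    exact: continuous_proj.
  exact: a_cont.
Qed.

(** Pointwise convergence controls finitely many points at once; this turns facts about the
    semigroup back into facts about orbits. *)
Lemma enveloping_approx (w : ell J X) (K : finType) (p : K -> J * X) (e : R) :
  enveloping a w -> 0 < e ->
  exists g, forall k, ball (w (p k)) e (a g (p k).1 (p k).2).
Proof.
move=> Ew e0.
have [|_ [[g _ <-] gP]] :=
    Ew [set w' : ell J X | forall k, ball (w (p k)) e (w' (p k))].
  have := @filter_forall _ K
    (fun k => [set w' : ell J X | ball (w (p k)) e (w' (p k))]) (nbhs w) _.
  apply=> k.
  exact: (@continuous_proj _ _ (p k) w _ (nbhsx_ballx _ e e0)).
by exists g.
Qed.

End Enveloping.

(** * The system N_d(X) *)

Lemma hausdorff_ballP {R : realType} (X : pseudoMetricType R) :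
  hausdorff_space X <-> forall x y : X, (forall e : R, 0 < e -> ball x e y) -> x = y.
Proof.
split=> hX x y xy; apply: hX.
  move=> A B /nbhs_ballP[e /= e0 eA] By; exists y; split.
    by apply: eA; exact: xy.
  exact: nbhs_singleton.
move=> e e0; have e2 : 0 < e / 2 by rewrite divr_gt0.
have [z [xz yz]] := xy _ _ (nbhsx_ballx x _ e2) (nbhsx_ballx y _ e2).
by rewrite [e]splitr; apply: ball_triangle xz _; exact: ball_sym.
Qed.

Lemma closure_ballP {R : realType} (X : pseudoMetricType R) (A : set X) (x : X) :
  closure A x <-> forall e : R, 0 < e -> exists2 y, A y & ball x e y.
Proof.
split=> [xA e e0|xA U /nbhs_ballP[e /= e0 eU]].
  by have [y [Ay xy]] := xA _ (nbhsx_ballx x e e0); exists y.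
by have [y Ay xy] := xA e e0; exists y; split=> //; exact: eU.
Qed.

Lemma continuous_into_finfun {R : realType} {I : finType}
    {X : pseudoMetricType R} {Y : topologicalType} (f : Y -> (I -> X)) :
  (forall i, continuous (fun y => f y i)) -> continuous f.
Proof.
move=> cf y; apply/cvg_ballP => e e0.
have := @filter_forall _ I (fun i => [set z | ball (f y i) e (f z i)]) (nbhs y) _.
by apply=> i; have /cvg_ballP := cf i y; exact.
Qed.

Lemma finfun_proj_cont {R : realType} {I : choiceType} {X : pseudoMetricType R}
  (i : I) : continuous (fun f : I -> X => f i).
Proof.
move=> f A /nbhs_ballP[e /= e0 eA]; apply/nbhs_ballP; exists e => // g fg.
by apply: eA; exact: fg.
Qed.

Lemma finfun_hausdorff {R : realType} {I : choiceType} {X : pseudoMetricType R} :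
  hausdorff_space X -> hausdorff_space (I -> X).
Proof.
move=> /hausdorff_ballP hX; apply/hausdorff_ballP => x y xy.
by apply/funext => i; apply: hX => e e0; exact: xy.
Qed.

Lemma zpow_act {R : realType} (S : system R int) (n : int) (x : S) :
  is_system set0 S -> zpow (act S 1) (act S (-1)) n x = act S n x.
Proof.
move=> [_ _ _ [act0 actD _]].
have iter_act z k : iter k (act S z) x = act S (z *+ k) x.
  elim: k => [|k IH]; first by rewrite mulr0n act0.
  by rewrite iterS IH mulrS actD.
case: n => k; first by rewrite /zpow iter_act natz.
by rewrite /zpow iter_act mulNrn natz NegzE.
Qed.

(** Starting from an abstract integer action, with generator [act S 1], makes N_d applicable to
    every level of a tower. *)
Definition Nsys {R : realType} (S : system R int) (d : nat) :
  system R (int * int)%type := Nd_sys (act S 1) (act S (-1)) d.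

Definition Nset {R : realType} (S : system R int) (d : nat) : set ('I_d -> S) :=
  Nd (act S 1) (act S (-1)) d.

Section NsysTheory.
Variables (R : realType) (S : system R int) (d : nat).
Hypothesis hS : is_system set0 S.
Let S_hausdorff : hausdorff_space S. Proof. by case: hS. Qed.
Let S_compact : compact [set: S]. Proof. by case: hS. Qed.
Let act_cont g : continuous (act S g). Proof. by case: hS. Qed.
Let act0 x : act S 0 x = x. Proof. by case: hS => _ _ _ []. Qed.
Let actD g h x : act S (g + h) x = act S g (act S h x).
Proof. by case: hS => _ _ _ []. Qed.

Lemma NsetP (y : 'I_d -> S) : Nset y <->
  forall e : R, 0 < e -> exists x p q,
    forall i : 'I_d, ball (y i) e (act S (p + (i.+1)%:Z * q) x).
Proof.
rewrite /Nset /Nd; split=> [/closure_ballP yN e e0|yN].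
  have [_ [x [p [q ->]]] yx] := yN e e0; exists x, p, q => i.
  by have := yx i; rewrite zpow_act.
apply/closure_ballP => e e0; have [x [p [q yx]]] := yN e e0.
exists (fun i : 'I_d => act S (p + (i.+1)%:Z * q) x) => //.
by exists x, p, q; apply/funext => i; rewrite zpow_act.
Qed.

Lemma Nset_closed : closed (@Nset R S d).
Proof. exact: closed_closure. Qed.

Lemma Nset_orbit (x : S) p q :
  Nset (fun i : 'I_d => act S (p + (i.+1)%:Z * q) x).
Proof. by apply/NsetP => e e0; exists x, p, q => i; exact: ballxx. Qed.

Definition dact (g : int * int) (i : 'I_d) (x : S) := act S (g.1 + g.2 * (i.+1)%:Z) x.

Lemma dact_cont g i : continuous (dact g i).
Proof. exact: act_cont. Qed.

Lemma dactD g h i x : dact (g + h) i x = dact g i (dact h i x).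
Proof. by rewrite /dact -actD mulrDl addrACA. Qed.

(** Acts as an induction principle for N_d: a closed condition need only be checked on arithmetic
    progressions along orbits. *)
Lemma Nset_min (D : set ('I_d -> S)) : closed D ->
  (forall x p q, D (fun i => act S (p + (i.+1)%:Z * q) x)) -> @Nset R S d `<=` D.
Proof.
move=> Dcl DN; apply: closure_subsetl => // _ [x [p [q ->]]].
suff -> : (fun i : 'I_d => zpow (act S 1) (act S (-1)) (p + i.+1%:Z * q) x) =
  (fun i => act S (p + (i.+1)%:Z * q) x) by exact: DN.
by apply/funext => i; rewrite zpow_act.
Qed.

Lemma Nset_dact g (y : 'I_d -> S) : Nset y -> Nset (fun i => dact g i (y i)).
Proof.
apply: (@Nset_min (fun y => Nset (fun i => dact g i (y i)))) => [|x p q].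
  apply: (@closed_preimage _ _ (fun y : 'I_d -> S => fun i => dact g i (y i)) (@Nset R S d)).
    apply: continuous_into_finfun => i y'.
    apply: (@continuous_comp _ _ _ (fun z : 'I_d -> S => z i) (dact g i)).
      exact: finfun_proj_cont.
    exact: dact_cont.
  exact: Nset_closed.
suff -> : (fun i : 'I_d => dact g i (act S (p + i.+1%:Z * q) x)) =
   (fun i => act S ((g.1 + p) + (i.+1)%:Z * (g.2 + q)) x) by exact: Nset_orbit.
by apply/funext => i; rewrite /dact -actD mulrDr addrACA [g.2 * _]mulrC.
Qed.

Definition NsetS (z : Nsys S d) : Nset (val z) := set_mem (valP z).

Definition Nmk (y : 'I_d -> S) (h : Nset y) : Nsys S d := exist _ y (mem_set h).

Lemma Nsys_actE g (z : Nsys S d) i : val (act (Nsys S d) g z) i = dact g i (val z i).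
Proof.
rewrite /Nsys /= /Nd_act.
have E : Gd_act (act S 1) (act S (-1)) g (val z) = (fun i => dact g i (val z i)).
  by apply/funext => j; rewrite /Gd_act zpow_act.
case: pselect => [h|[]] /=; first by rewrite E.
by rewrite E; exact/Nset_dact/NsetS.
Qed.

Lemma Nsys_ballE (z z' : Nsys S d) e :
  ball z e z' = forall i, ball (val z i) e (val z' i).
Proof. by []. Qed.

Lemma Nsys_inj (z z' : Nsys S d) : (forall i, val z i = val z' i) -> z = z'.
Proof. by move=> zz'; apply/val_inj/funext. Qed.

Lemma Nsys_coord_cont i : continuous (fun z : Nsys S d => val z i).
Proof.
move=> z A /nbhs_ballP[e /= e0 eA]; apply/nbhs_ballP; exists e => // z' zz'.
by apply: eA; exact: zz'.
Qed.

Lemma continuous_into_Nsys {Y : topologicalType} (f : Y -> Nsys S d) :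
  (forall i, continuous (fun y => val (f y) i)) -> continuous f.
Proof.
move=> cf; apply: (@continuous_comp_initial _ _ _ (set_val : Nd _ _ d -> _)).
exact: continuous_into_finfun.
Qed.

(** Tychonoff gives a cluster point in the product topology. Since there are only [d] coordinates,
    sup-metric balls are neighbourhoods there too, and the cluster point lies in N_d because N_d is
    closed. *)
Lemma Nsys_compact : compact [set: Nsys S d].
Proof.
move=> F FF _.
pose f (z : Nsys S d) : {ptws 'I_d -> S} := val z.
have [y [_ yF]] : [set: {ptws 'I_d -> S}] `&` cluster (f @ F) !=set0.
  apply: prod_compact; [by move=> _; exact: S_compact | exact: filterT].
have yFP A e : F A -> 0 < e -> exists2 z, A z & forall i, ball (y i) e (val z i).
  move=> FA e0.
  have [||_ [[z Az <-] yz]] := yF (f @` A) [set w | forall i, ball (y i) e (w i)].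
  - exact: filterS (@preimage_image _ _ f A) FA.
  - have := @filter_forall _ 'I_d
      (fun i => [set w : {ptws 'I_d -> S} | ball (y i) e (w i)]) (nbhs y) _.
    apply=> i; exact: (@continuous_proj _ _ i y _ (nbhsx_ballx _ e e0)).
  by exists z.
have yN : Nset y.
  apply: Nset_closed; apply/closure_ballP => e e0.
  have [z _ yz] := yFP _ e filterT e0.
  by exists (val z) => //; exact: NsetS.
exists (Nmk yN); split=> // A B FA /nbhs_ballP[e /= e0 eB].
by have [z Az yz] := yFP A e FA e0; exists z; split=> //; exact: eB.
Qed.

Lemma Nsys_system (K : set (int * int)) :
  (forall g, K g -> forall i x, dact g i x = x) -> is_system K (Nsys S d).
Proof.
move=> Ktriv; split.
- apply/hausdorff_ballP => z z' zz'; apply: Nsys_inj => i.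
  by move/hausdorff_ballP: S_hausdorff; apply => e e0; exact: zz'.
- exact: Nsys_compact.
- move=> g; apply: continuous_into_Nsys => i.
  under eq_fun do rewrite Nsys_actE.
  move=> z; apply: (@continuous_comp _ _ _ (fun z : Nsys S d => val z i) (dact g i)).
    exact: Nsys_coord_cont.
  exact: dact_cont.
split.
- by move=> z; apply: Nsys_inj => i; rewrite Nsys_actE /dact mul0r addr0 act0.
- by move=> g h z; apply: Nsys_inj => i; rewrite !Nsys_actE dactD.
- by move=> k Kk z; apply: Nsys_inj => i; rewrite Nsys_actE Ktriv.
Qed.

End NsysTheory.
Arguments NsetS {R S d} z.
Arguments Nset_orbit {R S d} hS x p q.

(** * Minimality of N_d(X) *)

Section Minimality.
Variables (R : realType) (S : system R int) (d : nat).
Hypothesis hS : is_system set0 S.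
Hypothesis minS : minimal S.
Let S_hausdorff : hausdorff_space S. Proof. by case: hS. Qed.
Let S_compact : compact [set: S]. Proof. by case: hS. Qed.
Let act_cont g : continuous (act S g). Proof. by case: hS. Qed.
Let actD g h x : act S (g + h) x = act S g (act S h x).
Proof. by case: hS => _ _ _ []. Qed.

Definition diag_act (n : int) (_ : 'I_d) (x : S) := act S n x.

Let EZ := enveloping diag_act.
Let EG := enveloping (@dact R S d).

Let EZ_stable : stable emul EZ.
Proof. by apply: enveloping_stable => *; [exact: act_cont | exact: actD]. Qed.

Let EG_stable : stable emul EG.
Proof. by apply: enveloping_stable => *; [exact: dact_cont | exact: dactD]. Qed.

Let EZ_sub_EG : EZ `<=` EG.
Proof.
apply: closureS => _ [n _ <-]; exists (n, 0) => //.
by apply/funext => -[j x]; rewrite /dact /= mul0r addr0.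
Qed.

Let spread (j : 'I_d) (f : ell 'I_d S) : ell 'I_d S := fun kx => f (j, kx.2).

(** On coordinate [j], an element of G_d acts as a single power of the generator; repeating it on
    all coordinates gives a diagonal element. The closed condition then passes to limits. *)
Let spread_EZ j f : EG f -> EZ (spread j f).
Proof.
move: f; apply: (enveloping_sub (D := spread j @^-1` EZ)).
  apply: closed_preimage; last exact: closed_closure.
  by apply: continuous_into_prod => kx; exact: (@continuous_proj _ _ (j, kx.2)).
move=> g; have : EZ (fun jx => diag_act (g.1 + g.2 * (j.+1)%:Z) jx.1 jx.2).
  exact: enveloping_act.
exact.
Qed.

Let EZ_diag f k j x : EZ f -> f (k, x) = f (j, x).
Proof.
move: f; apply: (enveloping_sub (D := [set f | f (k, x) = f (j, x)])) => //.
by apply: closed_eq_fun => //; exact: continuous_proj.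
Qed.

(** On one coordinate the image of [x] under [L] is compact and contains the orbit of a point, so it
    is all of [S] by minimality. Elements of [EZ] agree across coordinates. *)
Let ideal_surj (L : set (ell 'I_d S)) (x z : S) :
  L `<=` EZ -> closed L -> L !=set0 ->
  (forall a b, EZ a -> L b -> L (emul a b)) ->
  exists2 p, L p & forall j, p (j, x) = z.
Proof.
move=> LE Lcl [p0 Lp0] Lid.
(* For [d = 0] there is no coordinate to test, and any element of [L] serves. *)
have [[j0 _]|noj] := pselect (exists j : 'I_d, True); last first.
  by exists p0 => // j; case: noj; exists j.
suff [p Lp pxz] : [set p (j0, x) | p in L] z.
  by exists p => // j; rewrite (EZ_diag j j0 x (LE _ Lp)).
have Lco : compact L by apply: subclosed_compact Lcl (ell_compact _) _.
have Lxcl : closed [set p (j0, x) | p in L].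
  apply: compact_closed => //; apply: continuous_compact => //.
  by apply: continuous_subspaceT; exact: continuous_proj.
have : closure (range (fun g => act S g (p0 (j0, x)))) z by rewrite minS.
apply: closure_subsetl => // _ [g _ <-].
exists (emul (fun jx => diag_act g jx.1 jx.2) p0) => //.
by apply: Lid => //; exact: enveloping_act.
Qed.

Let EZ0 : EZ !=set0.
Proof. by exists (fun jx => diag_act 0 jx.1 jx.2); exact: enveloping_act. Qed.

Let EZ_compact : compact EZ. Proof. exact: enveloping_compact. Qed.
Let EG_compact : compact EG. Proof. exact: enveloping_compact. Qed.

(** The image of [(x, ..., x)] under [EG] is compact, hence closed. It contains every progression
    through [z]: a diagonal element moves [x] to [z], then an element of G_d spreads the
    coordinates. *)
Lemma diagonal_to_Nset (x : S) (y : 'I_d -> S) : Nset y ->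
  exists2 w, EG w & forall j, w (j, x) = y j.
Proof.
pose ev (w : ell 'I_d S) : 'I_d -> S := fun j => w (j, x).
move: y; have evco : compact [set ev w | w in EG].
  apply: continuous_compact => //; apply: continuous_subspaceT.
  by apply: continuous_into_finfun => i; exact: (@continuous_proj _ _ (i, x)).
suff sub : @Nset R S d `<=` [set ev w | w in EG].
  by move=> y /sub[w Ew <-]; exists w.
apply: (Nset_min hS) => [|z p q].
  exact: compact_closed (finfun_hausdorff S_hausdorff) evco.
have [r Er rxz] := @ideal_surj EZ x z (fun _ h => h) (@closed_closure _ _) EZ0 EZ_stable.
exists (emul (fun jx => dact (p, q) jx.1 jx.2) r).
  by apply: EG_stable; [exact: enveloping_act | exact: EZ_sub_EG].
by apply/funext => j; rewrite /ev /emul /= rxz /dact /= mulrC.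
Qed.

(* Glasner's argument.  Let [u] be an idempotent of a minimal left ideal of [EZ]
   fixing [x], and [w] in [EG] with [w (x, ..., x) = y].  An idempotent
   [v = p w u] of [EG w u] has all its coordinates in that ideal, so [u v = u];
   evaluating at [(x, ..., x)] gives [u p y = (x, ..., x)]. *)
Lemma Nset_to_diagonal (x : S) (y : 'I_d -> S) : Nset y ->
  exists2 w, EG w & forall j, w (j, y j) = x.
Proof.
move=> yN; have [w Ew wxy] := diagonal_to_Nset x yN.
have mulA := @emulA R 'I_d S; have mul_cont := @emul_cont R 'I_d S.
have hell := @ell_hausdorff R 'I_d S S_hausdorff.
have [L [LE Lcl L0 Lid Lidem]] :=
  minimal_left_ideal mulA mul_cont hell EZ_compact EZ0 EZ_stable.
have Lco : compact L by exact: subclosed_compact Lcl EZ_compact LE.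
pose B := L `&` [set p | forall j, p (j, x) = x].
have Bco : compact B.
  apply: compact_closedI => //.
  have -> : [set p : ell 'I_d S | forall j, p (j, x) = x] =
      \bigcap_(j in [set: 'I_d]) [set p : ell 'I_d S | p (j, x) = x].
    by apply/seteqP; split=> [p pE j _|p pE j]; [exact: pE | exact: (pE j I)].
  apply: closed_bigI => j _; apply: closed_eq_fun => //.
    exact: continuous_proj.
  exact: cst_continuous.
have B0 : B !=set0 by have [p Lp px] := ideal_surj x x LE Lcl L0 Lid; exists p.
have Bst : stable emul B.
  move=> p q [Lp px] [Lq qx]; split; first by apply: Lid => //; exact: LE.
  by move=> j; rewrite /emul /= qx px.
have [u [Lu ux] uu] := ellis_numakura mulA mul_cont hell Bco B0 Bst.
have Eu : EG u by exact/EZ_sub_EG/LE.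
pose C := [set emul f (emul w u) | f in EG].
have Cco : compact C.
  by apply: continuous_compact => //; apply: continuous_subspaceT; exact: mul_cont.
have C0 : C !=set0 by exists (emul w (emul w u)); exists w.
have Cst : stable emul C.
  move=> _ _ [f Ef <-] [g Eg <-]; exists (emul f (emul w (emul u g))) => //.
  by do 3 (apply: (EG_stable) => //).
have [v [p Ep vE] vv] := ellis_numakura mulA mul_cont hell Cco C0 Cst.
exists (emul u p); first exact: EG_stable.
move=> j.
(* [spread j] is multiplicative and fixes [u], whose coordinates all agree. *)
have svE : spread j v = emul (spread j (emul p w)) u.
  apply/funext => -[k z]; rewrite -vE /spread /emul /=.
  by rewrite (EZ_diag j k z (LE _ Lu)).
have Lv : L (spread j v).
  by rewrite svE; apply: Lid => //; apply: spread_EZ; exact: EG_stable.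
have svv : emul (spread j v) (spread j v) = spread j v.
  by apply/funext => -[k z]; rewrite -{3}vv.
have /(congr1 (fun f => f (j, x))) := Lidem u _ Lu Lv svv.
by rewrite /emul /spread /= ux -vE /emul /= ux wxy.
Qed.

(** An element of [EG] takes [y] to a diagonal point and another takes that point to [z]. Their
    product is approximated by a group element at the [d] coordinates of [y]. *)
Lemma Nsys_minimal : minimal (Nsys S d).
Proof.
move=> y; apply/seteqP; split=> // z _; apply/closure_ballP => e e0.
have [x _] : exists x : S, True.
  by have /(NsetP hS)/(_ _ ltr01)[x _] := NsetS y; exists x.
have [r Er ryx] := Nset_to_diagonal x (NsetS y).
have [w Ew wxz] := diagonal_to_Nset x (NsetS z).
have [g gP] := enveloping_approx (fun j : 'I_d => (j, val y j)) (EG_stable Ew Er) e0.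
exists (act (Nsys S d) g y); first by exists g.
rewrite Nsys_ballE => j; rewrite (Nsys_actE hS).
by have := gP j; rewrite /emul /= ryx wxz.
Qed.

End Minimality.

(** * Lifting extensions *)

Section Proximal.
Variables (R : realType) (G : zmodType) (S : system R G).
Hypothesis hS : is_system set0 S.
Let S_hausdorff : hausdorff_space S. Proof. by case: hS. Qed.
Let S_compact : compact [set: S]. Proof. by case: hS. Qed.
Let act_cont g : continuous (act S g). Proof. by case: hS. Qed.
Let actD g h x : act S (g + h) x = act S g (act S h x).
Proof. by case: hS => _ _ _ []. Qed.

(** With a one-point index, [enveloping] is the usual enveloping semigroup of [S]. *)
Definition unit_act (g : G) (_ : unit) (x : S) := act S g x.

Let E := enveloping unit_act.

Let E_compact : compact E. Proof. exact: enveloping_compact. Qed.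

(** The closures of the sets of group elements bringing [x] and [y] within [e] form a chain in a
    compact space; a common point identifies [x] and [y]. *)
Lemma proximal_pair_collapse (x y : S) : proximal_pair x y ->
  exists2 p, E p & p (tt, x) = p (tt, y).
Proof.
move=> xy.
pose B (e : {e : R | 0 < e}) : set (ell unit S) :=
  closure ((fun g => (fun jx => unit_act g jx.1 jx.2) : ell unit S) @`
    [set g | ball (act S g x) (sval e) (act S g y)]).
have [||e e'|p Ep Bp] := @compact_chain _ E _ B (exist _ 1 ltr01) E_compact.
- by move=> e; exact: closed_closure.
- move=> [e e0]; have [g gxy] := xy e e0.
  exists (fun jx => unit_act g jx.1 jx.2); split; last exact: enveloping_act.
  by apply: subset_closure; exists g.
- case: (lerP (sval e) (sval e')) => [|/ltW] ee'; [left|right];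
    apply: closureS => _ [g gxy <-]; exists g => //; exact: le_ball gxy.
exists p => //; move/hausdorff_ballP: S_hausdorff; apply => e e0.
have e2 : 0 < e / 2 by rewrite divr_gt0.
have e4 : 0 < e / 2 / 2 by rewrite divr_gt0.
have nb (z : S) r : 0 < r ->
    nbhs p [set w : ell unit S | ball (p (tt, z)) r (w (tt, z))].
  by move=> r0; exact: (@continuous_proj _ _ (tt, z) p _ (nbhsx_ballx _ _ r0)).
(* Both [p x] and [p y] are within [e / 2] of [g y], the first by way of [g x] in two steps of
   [e / 4]. *)
have [_ [[g gxy <-] [pgx pgy]]] :=
  Bp (exist (fun r => 0 < r) _ e4) _ (filterI (nb x _ e4) (nb y _ e2)).
rewrite [e]splitr; apply: (@ball_triangle _ _ (act S g y)); last exact: ball_sym.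
by rewrite [e / 2]splitr; apply: ball_triangle pgx gxy.
Qed.

(** Induction on the list: if [p] collapses the tail, it still sends the head to a pair in one
    fibre. That pair is proximal, so some [q] collapses it, and [q p] collapses everything. *)
Lemma proximal_ext_collapse (S' : system R G) (pi : S -> S') (s : seq (S * S)) :
  hausdorff_space S' -> factor_map pi -> proximal_ext pi ->
  {in s, forall xy, pi xy.1 = pi xy.2} ->
  exists2 p, E p & {in s, forall xy, p (tt, xy.1) = p (tt, xy.2)}.
Proof.
move=> hS' [pi_cont _ pi_act] pi_prox.
elim: s => [_|[x y] s IH sE].
  by exists (fun jx => unit_act 0 jx.1 jx.2) => //; exact: enveloping_act.
have [|p Ep ps] := IH; first by move=> xy xys; apply: sE; rewrite in_cons xys orbT.
have pixy : pi (p (tt, x)) = pi (p (tt, y)).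
  move: p Ep {ps}.
  apply: (enveloping_sub (D := [set p | pi (p (tt, x)) = pi (p (tt, y))])).
    by apply: closed_eq_fun => // p; apply: continuous_comp;
      (exact: (@continuous_proj _ _ (tt, _)) || exact: pi_cont).
  by move=> g /=; rewrite !pi_act (sE (x, y)) // mem_head.
have [q Eq qp] := proximal_pair_collapse (pi_prox _ _ pixy).
exists (emul q p).
  by apply: (enveloping_stable (a := unit_act)) => // *; [exact: act_cont | exact: actD].
move=> xy; rewrite in_cons => /orP[/eqP -> //|xys].
by rewrite /emul /= ps.
Qed.

(* [k] acts trivially on [S'], so [x] and [k x] are proximal and some [p]
   in the enveloping semigroup sends them to the same point, which is then
   fixed by [k]. *)
Lemma proximal_ext_trivial (S' : system R G) (pi : S -> S') (k : G) :
  minimal S -> hausdorff_space S' -> factor_map pi -> proximal_ext pi ->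
  (forall x, act S' k x = x) -> forall x, act S k x = x.
Proof.
move=> minS hS' [_ _ pi_act] pi_prox k_triv x.
have [p Ep pxk] : exists2 p, E p & p (tt, x) = p (tt, act S k x).
  by apply/proximal_pair_collapse/pi_prox; rewrite pi_act k_triv.
have pk : p (tt, act S k x) = act S k (p (tt, x)).
  move: p Ep {pxk}; apply: (enveloping_sub
    (D := [set p | p (tt, act S k x) = act S k (p (tt, x))])) => [|g].
    apply: closed_eq_fun => //; first exact: continuous_proj.
    move=> p; apply: (@continuous_comp _ _ _ (fun p : ell unit S => p (tt, x))).
      exact: continuous_proj.
    exact: act_cont.
  by rewrite /unit_act /= -!actD addrC.
(* As the group is abelian, [k] fixes the whole orbit of [p x], hence its closure [S]. *)
have : closure (range (fun g => act S g (p (tt, x)))) x by rewrite minS.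
apply: (closure_subsetl (B := [set z | act S k z = z])) => [|_ [g _ <-]].
  by apply: closed_eq_fun => // z; exact: cvg_id.
by rewrite /= -actD addrC actD -pk -pxk.
Qed.

End Proximal.

(** The default [z0] makes the map total without a proof argument; for a factor map [Nset_factor]
    rules that branch out. *)
Definition Nmap {R : realType} {S1 S2 : system R int} {d : nat} (pi : S1 -> S2)
    (z0 : Nsys S2 d) (z : Nsys S1 d) : Nsys S2 d :=
  if pselect (Nset (pi \o (val z : 'I_d -> S1))) is left h then Nmk h else z0.

Section NmapTheory.
Variables (R : realType) (S1 S2 : system R int) (d : nat) (pi : S1 -> S2).
Variable z0 : Nsys S2 d.
Hypotheses (hS1 : is_system set0 S1) (hS2 : is_system set0 S2).
Hypothesis pi_factor : factor_map pi.
Let S2_hausdorff : hausdorff_space S2. Proof. by case: hS2. Qed.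

Lemma Nset_factor (y : 'I_d -> S1) : Nset y -> Nset (pi \o y).
Proof.
have [pi_cont _ pi_act] := pi_factor.
apply: (Nset_min hS1 (D := fun y => Nset (pi \o y))) => [|x p q].
  apply: (@closed_preimage _ _ (fun y : 'I_d -> S1 => pi \o y) (@Nset R S2 d)).
    apply: continuous_into_finfun => i y'.
    apply: (@continuous_comp _ _ _ (fun z : 'I_d -> S1 => z i) pi).
      exact: finfun_proj_cont.
    exact: pi_cont.
  exact: Nset_closed.
suff -> : pi \o (fun i : 'I_d => act S1 (p + i.+1%:Z * q) x) =
   (fun i => act S2 (p + (i.+1)%:Z * q) (pi x)) by exact: Nset_orbit.
by apply/funext => i /=; rewrite pi_act.
Qed.

Lemma NmapE z i : val (Nmap pi z0 z) i = pi (val z i).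
Proof.
by rewrite /Nmap; case: pselect => // -[]; exact/Nset_factor/NsetS.
Qed.

Lemma Nmap_factor : factor_map (Nmap pi z0).
Proof.
have [pi_cont pi_surj pi_act] := pi_factor.
split.
- apply: continuous_into_Nsys => i; under eq_fun do rewrite NmapE.
  move=> z; apply: (@continuous_comp _ _ _ (fun z : Nsys S1 d => val z i) pi).
    exact: Nsys_coord_cont.
  exact: pi_cont.
- pose f (z : Nsys S1 d) : 'I_d -> S2 := fun i => pi (val z i).
  have f_cont : continuous f.
    apply: continuous_into_finfun => i z.
    apply: (@continuous_comp _ _ _ (fun z : Nsys S1 d => val z i) pi).
      exact: Nsys_coord_cont.
    exact: pi_cont.
  have fcl : closed (f @` [set: Nsys S1 d]).
    apply: compact_closed; first exact: finfun_hausdorff.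
    apply: continuous_compact; last exact: Nsys_compact.
    exact: continuous_subspaceT.
  (* The image is closed, and contains every progression because base points lift along [pi]. *)
  move=> y; have [z _ zy] : range f (val y).
    apply: (Nset_min hS2 fcl) (NsetS y) => x p q; have [x' <-] := pi_surj x.
    exists (Nmk (Nset_orbit hS1 x' p q)) => //.
    by apply/funext => i; rewrite /f /= pi_act.
  by exists z; apply: Nsys_inj => i; rewrite NmapE -zy.
- move=> g z; apply: Nsys_inj => i.
  by rewrite NmapE !Nsys_actE // NmapE pi_act.
Qed.

Lemma Nmap_equicontinuous : equicontinuous_ext pi -> equicontinuous_ext (Nmap pi z0).
Proof.
move=> pi_equi e e0; have [dl dl0 dlP] := pi_equi e e0.
exists dl => // x y xy xdly g; rewrite Nsys_ballE => i.
rewrite !Nsys_actE //; apply: dlP; last exact: xdly.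
by rewrite -!NmapE xy.
Qed.

Lemma Nmap_proximal : proximal_ext pi -> proximal_ext (Nmap pi z0).
Proof.
move=> pi_prox x y xy e e0.
have [s|p Ep pxy] := proximal_ext_collapse
    (s := [seq (val x i, val y i) | i <- enum 'I_d]) hS1 S2_hausdorff pi_factor pi_prox.
  by case/mapP => i _ -> /=; rewrite -!NmapE xy.
have e2 : 0 < e / 2 by rewrite divr_gt0.
have [g gP] := enveloping_approx
  (fun k : 'I_d + 'I_d => (tt, match k with inl i => val x i | inr i => val y i end))
  Ep e2.
(* [(g, 0)] is the diagonal element, acting by [g] on each coordinate. *)
exists (g, 0); rewrite Nsys_ballE => i.
have {}pxy : p (tt, val x i) = p (tt, val y i).
  by apply: (pxy (val x i, val y i)); apply: map_f; rewrite mem_enum.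
rewrite !Nsys_actE // /dact /= mul0r addr0 [e]splitr.
have := gP (inr i); rewrite /= -pxy; apply: ball_triangle.
by apply: ball_sym; exact: (gP (inl i)).
Qed.

Lemma Nmap_almost_one_one : almost_one_one_ext pi -> almost_one_one_ext (Nmap pi z0).
Proof.
move=> [x xP]; exists (Nmk (Nset_orbit hS1 x 0 0)) => y yx.
apply: Nsys_inj => i /=; have [_ _ _ [act0 _ _]] := hS1.
rewrite mulr0 addr0 act0; apply: xP.
by rewrite -!NmapE yx NmapE /= mulr0 addr0 act0.
Qed.

Lemma Nmap_inj : injective pi -> injective (Nmap pi z0).
Proof.
move=> pi_inj x y xy; apply: Nsys_inj => i; apply: pi_inj.
by rewrite -!NmapE xy.
Qed.

End NmapTheory.

Lemma Nsys_distal {R : realType} (S : system R int) (d : nat) :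
  is_system set0 S -> distal S -> distal (Nsys S d).
Proof.
move=> hS dS x y xy; apply: Nsys_inj => i; apply: dS => e e0.
have [g gxy] := xy e e0; exists (g.1 + g.2 * (i.+1)%:Z).
by move: gxy; rewrite Nsys_ballE => /(_ i); rewrite !Nsys_actE.
Qed.

(** * Towers *)

Arguments tlt {R G} t _ _.
Arguments tsys {R G} t _.
Arguments tpi {R G} t l m _.

Lemma tower_inhabited {R : realType} {G : zmodType} (P : ext_kind R G)
    (K : set G) (T : tower R G) (S : system R G) :
  is_tower K P T S -> exists x : S, True.
Proof.
move=> [_ [_ [_ [_ [_ [[bot [top [botP [_ [[x0 _] [phi _]]]]]]
  [_ [_ [pi_factor _]]]]]]]]].
have [topE|bt] := botP top; first by exists (phi (eq_rect _ (tsys T) x0 _ topE)).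
by have [_ /(_ x0)[x _] _] := pi_factor _ _ bt; exists (phi x).
Qed.

(** The kinds of extension stay parameters, so that one argument serves the PI and HPI towers. *)
Lemma Nsys_tower {R : realType} (d : nat) (P1 : ext_kind R int)
    (P2 : ext_kind R (int * int)%type) (K : set (int * int)) (T : tower R int)
    (S : system R int) :
  (forall (S1 S2 : system R int) (pi : S1 -> S2) (z0 : Nsys S2 d),
    is_system set0 S1 -> is_system set0 S2 -> factor_map pi -> P1 _ _ pi ->
    P2 _ _ (Nmap pi z0)) ->
  is_system set0 S ->
  (forall g, K g -> forall (i : 'I_d) (x : S), dact g i x = x) ->
  is_tower set0 P1 T S ->
  exists T' : tower R (int * int)%type, is_tower K P2 T' (Nsys S d).
Proof.
move=> P12 hS Ktriv [irr [trans [total [wf [count [[bot [top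
  [botP [topP [[x0 x0P] [phi phi_iso]]]]]]
  [sys [pi_id [pi_factor [pi_comp [pi_succ pi_lim]]]]]]]]]]].
have hT l : is_system set0 (tsys T l) by case: (sys l).
have [phi_factor phi_inj] := phi_iso.
have pi_le l m : tle m l -> factor_map (tpi T l m).
  move=> [->|ml]; last exact: pi_factor.
  have -> : tpi T l l = id by apply/funext => x; exact: pi_id.
  by split=> // [x|y]; [exact: cvg_id | exists y].
have ex_z0 l : exists z : Nsys (tsys T l) d, True.
  have [_ /(_ x0)[x _] _] := pi_le _ _ (botP l).
  by exists (Nmk (Nset_orbit (hT l) x 0 0)).
pose z0 l := sval (cid (ex_z0 l)).
pose pi' l m : Nsys (tsys T l) d -> Nsys (tsys T m) d := Nmap (tpi T l m) (z0 m).
pose T' := Tower (tlt T) pi'.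
have pi'E l m z i : tle m l -> val (pi' l m z) i = tpi T l m (val z i).
  by move=> ml; apply: (NmapE _ (hT l) (hT m) (pi_le _ _ ml)).
have pi'_factor l m : tle m l -> factor_map (pi' l m).
  by move=> ml; apply: Nmap_factor => //; exact: pi_le.
have pi'_comp l m n z : tlt T n m -> tlt T m l -> pi' m n (pi' l m z) = pi' l n z.
  move=> nm ml; apply: Nsys_inj => i.
  rewrite !pi'E; [exact: pi_comp | by right; exact: trans ml | by right..].
(* Triviality passes from [S] to the isomorphic top level, then down to its factors. *)
have Ktriv' l g : K g -> forall (i : 'I_d) (x : tsys T l), dact g i x = x.
  move=> Kg i x; have [_ pi_surj pi_act] := pi_le _ _ (topP l).
  have [y <-] := pi_surj x; rewrite /dact -pi_act; congr (tpi _ _ _ _).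
  by apply: phi_inj; have [_ _ ->] := phi_factor; exact: Ktriv.
have hN l : is_system K (Nsys (tsys T l) d).
  by apply: Nsys_system => // g Kg; exact: Ktriv'.
exists T'; split=> //; split=> //; split=> //; split=> //; split=> //; split.
  exists bot, top; split=> //; split=> //; split.
    exists (z0 bot) => z; apply: Nsys_inj => i.
    by rewrite [LHS]x0P [RHS]x0P.
  have [x _] := ex_z0 top.
  have y0 : Nsys S d by exact: (Nmk (Nset_factor (hT top) hS phi_factor (NsetS x))).
  exists (Nmap phi y0); split; first exact: Nmap_factor.
  exact: Nmap_inj.
split; first by move=> l; split; [exact: hN | case: (sys l) => _; exact: Nsys_minimal].
split.
  by move=> l z; apply: Nsys_inj => i; rewrite pi'E; [exact: pi_id | left].
split; first by move=> l m ml; apply: pi'_factor; right.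
split; first by move=> l m n z; exact: pi'_comp.
split.
  move=> l m ml succ; apply: P12 => //; first exact: pi_factor.
  exact: pi_succ.
move=> l ex_lt lim xs xs_comp /=.
pose A (m : {m | tlt T m l}) : set (Nsys (tsys T l) d) :=
  [set z | pi' l (sval m) z = xs (sval m) (proj2_sig m)].
have [m0 m0l] := ex_lt.
have [|[m ml]|[m ml] [n nl]|z _ zP] :=
  @compact_chain _ setT _ A (exist _ m0 m0l) (Nsys_compact (hT l)).
- move=> [m ml]; apply: closed_eq_fun; first by case: (hN m).
    by case: (pi'_factor l m _) => //; right.
  exact: cst_continuous.
- have [|_ /(_ (xs m ml))[z zm] _] := pi'_factor l m; first by right.
  by exists z; split.
- have sub m' n' (m'l : tlt T m' l) (n'l : tlt T n' l) : tlt T n' m' ->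
      A (exist _ m' m'l) `<=` A (exist _ n' n'l).
    move=> nm z; rewrite /A /= => zm; rewrite -(pi'_comp l m' n') // zm.
    exact: xs_comp.
  case: (total m n) => [mn|mn|nm]; [right; exact: sub| |left; exact: sub].
  by left; move: nl; rewrite -mn => nl; rewrite (Prop_irrelevance nl ml).
exists z; split=> [m ml|z' z'P]; first exact: (zP (exist _ m ml)).
apply: Nsys_inj => i.
(* Uniqueness in the inverse limit, applied to the projections of [z i], shows that lower levels
   separate points, so [z i = z' i]. *)
have [|x [_ xP]] := pi_lim l ex_lt lim (fun m _ => tpi T l m (val z i)).
  by move=> m n ml nl nm; exact: pi_comp.
rewrite -(xP (val z i)) // -(xP (val z' i)) // => m ml.
rewrite -!pi'E; [ | by right..].
by rewrite z'P (zP (exist _ m ml)).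
Qed.

(** * The integer action of a homeomorphism, and the conclusion *)

Lemma Zsys_system {R : realType} (X : pseudoMetricType R) (T Tinv : X -> X) :
  hausdorff_space X -> compact [set: X] -> continuous T -> continuous Tinv ->
  cancel T Tinv -> cancel Tinv T -> is_system set0 (Zsys T Tinv).
Proof.
move=> hX cX cT cTinv TK TinvK.
have iter_cont (f : X -> X) n : continuous f -> continuous (iter n f).
  move=> cf; elim: n => [|n IH] x; first exact: cvg_id.
  by apply: (@continuous_comp _ _ _ (iter n f) f); [exact: IH | exact: cf].
have zpowS n x : zpow T Tinv (1 + n) x = T (zpow T Tinv n x).
  case: n => [//|[|k]]; first by rewrite /= TinvK.
  (* [Negz k] stands for [-(k+1)], so adding 1 removes one factor [Tinv]. *)
  have -> : 1 + Negz k.+1 = Negz k by rewrite !NegzE -addn1 PoszD opprD addrCA subrr addr0.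
  by rewrite /= TinvK.
have zpowP n x : zpow T Tinv (-1 + n) x = Tinv (zpow T Tinv n x).
  by rewrite -[in RHS](addKr (-1) n) opprK zpowS TK.
split=> //.
  by case=> n; exact: iter_cont.
split=> // m n x /=.
elim/int_rec: m => [|m IH|m IH]; first by rewrite add0r.
  by rewrite -add1n PoszD -addrA !zpowS IH.
by rewrite -add1n PoszD opprD -addrA !zpowP IH.
Qed.

Theorem theorem5p7 (R : realType) (X : pseudoMetricType R) (T Tinv : X -> X)
  (d : nat) :
  hausdorff_space X -> compact [set: X] ->
  continuous T -> continuous Tinv ->
  cancel T Tinv -> cancel Tinv T ->
  minimal (Zsys T Tinv) ->
  [/\ distal (Zsys T Tinv) -> distal (Nd_sys T Tinv d),
      PI set0 (Zsys T Tinv) -> PI (Gd_ker T Tinv d) (Nd_sys T Tinv d)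
    & HPI set0 (Zsys T Tinv) -> HPI (Gd_ker T Tinv d) (Nd_sys T Tinv d)].
Proof.
move=> hX cX cT cTinv TK TinvK minX.
have hZ := Zsys_system hX cX cT cTinv TK TinvK.
have ker_triv g : Gd_ker T Tinv d g ->
    forall (i : 'I_d) (x : Zsys T Tinv), dact g i x = x.
  by move=> gK i x; have /(congr1 (fun f => f i)) := gK (fun=> x).
have -> : Nd_sys T Tinv d = Nsys (Zsys T Tinv) d by [].
split.
- exact: Nsys_distal.
- move=> [S' [pi [hS' [minS' [[tow towP] [pi_factor pi_prox]]]]]].
  (* The kernel is defined on [X], but must act trivially on N_d of the proximal extension [S'] as
     well; each coordinate moves by one integer that is trivial on [X], hence on [S']. *)
  have ker_triv' g : Gd_ker T Tinv d g -> forall (i : 'I_d) (x : S'), dact g i x = x.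
    move=> gK i; apply: (proximal_ext_trivial (S' := Zsys T Tinv)
      hS' minS' hX pi_factor pi_prox).
    exact: ker_triv gK i.
  have [x0 _] := tower_inhabited towP.
  pose z0 := Nmk (Nset_orbit hZ (pi x0) 0 0) : Nsys _ d.
  exists (Nsys S' d), (Nmap pi z0); split.
    exact: Nsys_system.
  split; first exact: Nsys_minimal.
  split; last by split; [exact: Nmap_factor | exact: Nmap_proximal].
  apply: (Nsys_tower _ hS' ker_triv' towP) => S1 S2 rho z1 h1 h2 rho_factor.
  by move=> [|] ?; [left; exact: Nmap_proximal | right; exact: Nmap_equicontinuous].
- move=> [tow towP].
  apply: (Nsys_tower _ hZ ker_triv towP) => S1 S2 rho z0 h1 h2 rho_factor.
  by move=> [|] ?; [left; exact: Nmap_almost_one_one | right; exact: Nmap_equicontinuous].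
Qed.
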